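(* Let $\mathbf G\in\mathbb R^{d\times k}$ have orthonormal columns, $\mathbf G^\top\mathbf G=\mathbf I_k$ (with $k=0$ allowed, meaning that there is no constraint from $\mathbf G$ and $\mathbf G\mathbf G^\top=\mathbf 0$). Let $\mathcal M_t=\{\mathbf U\in\mathbb R^{d\times r}\mid \mathbf U^\top\mathbf U=\mathbf I_r,\ \mathbf G^\top\mathbf U=\mathbf 0\}$, and let $\mathbf U\in\mathcal M_t$. For any $\mathbf Z\in\mathbb R^{d\times r}$, define $$\mathcal P_{\mathcal T_{\mathbf U}\mathcal M_t}(\mathbf Z)=\mathbf Z_0-\mathbf U\,\mathrm{sym}(\mathbf U^\top\mathbf Z_0),\qquad \mathbf Z_0=(\mathbf I_d-\mathbf G\mathbf G^\top)\mathbf Z .$$ Then $\mathcal P_{\mathcal T_{\mathbf U}\mathcal M_t}(\mathbf Z)$ is the unique solution of $$\min_{\mathbf Y\in\mathcal T_{\mathbf U}\mathcal M_t}\ \|\mathbf Y-\mathbf Z\|_F^2,$$ and hence it is the orthogonal projection of $\mathbf Z$ onto the tangent space $\mathcal T_{\mathbf U}\mathcal M_t$ under the Frobenius norm.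
   Context: All matrices are real; $d,r,k$ are the matrix dimensions. $\|\cdot\|_F$ is the Frobenius norm, induced by the inner product $\langle\mathbf A,\mathbf B\rangle=\mathrm{tr}(\mathbf A^\top\mathbf B)$. For a square matrix $\mathbf A$, $\mathrm{sym}(\mathbf A)=\tfrac12(\mathbf A+\mathbf A^\top)$. The tangent space of $\mathcal M_t$ at $\mathbf U\in\mathcal M_t$ is the linear subspace $$\mathcal T_{\mathbf U}\mathcal M_t=\{\mathbf Z\in\mathbb R^{d\times r}\mid \mathbf U^\top\mathbf Z+\mathbf Z^\top\mathbf U=\mathbf 0,\ \mathbf G^\top\mathbf Z=\mathbf 0\}.$$ The subscript $t$ is only a label (a task index) and plays no mathematical role. *)

(* Defs.v *)
From HB Require Import structures.
From mathcomp Require Import all_boot all_order all_algebra.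

Set Implicit Arguments.
Unset Strict Implicit.
Unset Printing Implicit Defensive.

Import Order.TTheory GRing.Theory Num.Theory.
Local Open Scope ring_scope.

Definition frob_inner (R : rcfType) (m n : nat) (A B : 'M[R]_(m, n)) : R :=
  \tr (A^T *m B).

Definition frob_norm (R : rcfType) (m n : nat) (A : 'M[R]_(m, n)) : R :=
  Num.sqrt (frob_inner A A).

Definition sym_mx (R : rcfType) (n : nat) (A : 'M[R]_n) : 'M[R]_n :=
  2^-1 *: (A + A^T).

(* For k = 0 the constraint G^T *m U = 0 is vacuous and G *m G^T = 0. *)
Definition manifold (R : rcfType) (d r k : nat) (G : 'M[R]_(d, k)) :
    {pred 'M[R]_(d, r)} :=
  [pred U : 'M[R]_(d, r) | (U^T *m U == 1%:M) && (G^T *m U == 0)].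

Definition tangent_space (R : rcfType) (d r k : nat)
    (G : 'M[R]_(d, k)) (U : 'M[R]_(d, r)) : {pred 'M[R]_(d, r)} :=
  [pred Z : 'M[R]_(d, r) |
    (U^T *m Z + Z^T *m U == 0) && (G^T *m Z == 0)].

Lemma tangent_space_submod_closed (R : rcfType) (d r k : nat)
    (G : 'M[R]_(d, k)) (U : 'M[R]_(d, r)) :
  submod_closed (tangent_space G U).
Proof.
split=> [|a Y Z].
  by rewrite inE trmx0 mul0mx !mulmx0 addr0 !eqxx.
rewrite !inE => /andP[/eqP hY /eqP gY] /andP[/eqP hZ /eqP gZ].
rewrite !mulmxDr -!scalemxAr gY gZ scaler0 addr0 eqxx andbT.
by rewrite linearD linearZ /= mulmxDl -scalemxAl addrACA -scalerDr hY hZ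
  scaler0 addr0.
Qed.

HB.instance Definition _ (R : rcfType) (d r k : nat)
    (G : 'M[R]_(d, k)) (U : 'M[R]_(d, r)) :=
  GRing.isSubmodClosed.Build R 'M[R]_(d, r) (tangent_space G U)
    (tangent_space_submod_closed G U).

Definition tangent_proj (R : rcfType) (d r k : nat)
    (G : 'M[R]_(d, k)) (U Z : 'M[R]_(d, r)) : 'M[R]_(d, r) :=
  let Z0 := (1%:M - G *m G^T) *m Z in
  Z0 - U *m sym_mx (U^T *m Z0).

Definition is_minimizer (R : rcfType) (T : Type) (S : {pred T}) (f : T -> R)
    (x : T) : Prop :=
  x \in S /\ forall y : T, y \in S -> f x <= f y.

Definition is_orthogonal_projection (R : rcfType) (m n : nat)
    (S : {pred 'M[R]_(m, n)}) (Z P : 'M[R]_(m, n)) : Prop :=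
  P \in S /\ forall Y : 'M[R]_(m, n), Y \in S -> frob_inner (Z - P) Y = 0.

(* Main.v *)
(* The residual of the projection is Z - P = G G^T Z + U S with S symmetric. On
   the tangent space G^T Y = 0 and U^T Y is skew, and symmetric matrices are
   orthogonal to skew ones, so the residual is orthogonal to the tangent space;
   minimality and uniqueness then follow from Pythagoras. *)
Require Import Defs.
From mathcomp Require Import all_boot all_order all_algebra.

Set Implicit Arguments.
Unset Strict Implicit.
Unset Printing Implicit Defensive.

Import Order.TTheory GRing.Theory Num.Theory.
Local Open Scope ring_scope.

Lemma frob_innerE (R : rcfType) (m n : nat) (A B : 'M[R]_(m, n)) :
  frob_inner A B = \sum_j \sum_i A i j * B i j.
Proof.
by apply: eq_bigr => j _; rewrite mxE; apply: eq_bigr => i _; rewrite mxE.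
Qed.

Lemma frob_innerC (R : rcfType) (m n : nat) (A B : 'M[R]_(m, n)) :
  frob_inner A B = frob_inner B A.
Proof. by rewrite /frob_inner -mxtrace_tr trmx_mul trmxK. Qed.

Lemma frob_innerDl (R : rcfType) (m n : nat) (A B C : 'M[R]_(m, n)) :
  frob_inner (A + B) C = frob_inner A C + frob_inner B C.
Proof. by rewrite /frob_inner linearD mulmxDl linearD. Qed.

Lemma frob_innerNl (R : rcfType) (m n : nat) (A B : 'M[R]_(m, n)) :
  frob_inner (- A) B = - frob_inner A B.
Proof. by rewrite /frob_inner linearN mulNmx linearN. Qed.

Lemma frob_inner_mull (R : rcfType) (m n p : nat) (A : 'M[R]_(m, n))
    (B : 'M[R]_(n, p)) (C : 'M[R]_(m, p)) :
  frob_inner (A *m B) C = frob_inner B (A^T *m C).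
Proof. by rewrite /frob_inner trmx_mul mulmxA. Qed.

Lemma frob_inner_ge0 (R : rcfType) (m n : nat) (A : 'M[R]_(m, n)) :
  0 <= frob_inner A A.
Proof.
rewrite frob_innerE; apply: sumr_ge0 => j _; apply: sumr_ge0 => i _.
by rewrite -expr2 sqr_ge0.
Qed.

(** The entrywise form is a double sum of squares, so a zero total forces first each column sum and
    then each square to vanish. *)
Lemma frob_inner_eq0 (R : rcfType) (m n : nat) (A : 'M[R]_(m, n)) :
  (frob_inner A A == 0) = (A == 0).
Proof.
apply/eqP/eqP => [A0|->]; last by rewrite /frob_inner mulmx0 mxtrace0.
have sq_ge0 i j : 0 <= A i j * A i j by rewrite -expr2 sqr_ge0.
apply/matrixP => i j; rewrite mxE; apply/eqP; rewrite -sqrf_eq0 expr2; apply/eqP.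
rewrite frob_innerE in A0.
have colj : \sum_i A i j * A i j = 0.
  by apply: (psumr_eq0P _ A0) => // l _; apply: sumr_ge0.
exact: (psumr_eq0P _ colj).
Qed.

Lemma frob_inner_sym_skew (R : rcfType) (n : nat) (S A : 'M[R]_n) :
  S^T = S -> A^T = - A -> frob_inner S A = 0.
Proof.
(* Swapping the arguments in one of the two copies turns it into the trace of [- (A *m S)], while
   the other is the trace of [S *m A]; cyclicity of the trace makes them cancel. *)
move=> symS skewA; suff: frob_inner S A *+ 2 == 0 by rewrite mulrn_eq0 => /eqP.
rewrite mulr2n {1}frob_innerC /frob_inner skewA symS mulNmx linearN /=.
by rewrite mxtrace_mulC addNr.
Qed.

Lemma frob_norm_sqr (R : rcfType) (m n : nat) (A : 'M[R]_(m, n)) :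
  frob_norm A ^+ 2 = frob_inner A A.
Proof. by rewrite sqr_sqrtr ?frob_inner_ge0. Qed.

Lemma frob_pythagoras (R : rcfType) (m n : nat) (A B : 'M[R]_(m, n)) :
  frob_inner A B = 0 ->
  frob_norm (B - A) ^+ 2 = frob_norm B ^+ 2 + frob_norm A ^+ 2.
Proof.
move=> AB0; rewrite !frob_norm_sqr frob_innerDl frob_innerNl.
rewrite (frob_innerC B) (frob_innerC A (B - A)) !frob_innerDl !frob_innerNl.
by rewrite (frob_innerC B A) AB0 oppr0 addr0 add0r opprK.
Qed.

(** For [Y] in [S] the difference [Y - P] lies in [S], hence is orthogonal to [Z - P]. The objective
    at [Y] thus exceeds its value at [P] by exactly the squared distance from [Y] to [P]. *)
Lemma orthogonal_projection_unique_minimizer (R : rcfType) (m n : nat)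
    (S : zmodClosed 'M[R]_(m, n)) (Z P : 'M[R]_(m, n)) :
  is_orthogonal_projection S Z P ->
  unique (is_minimizer S (fun Y => frob_norm (Y - Z) ^+ 2)) P.
Proof.
move=> [PS orthP].
have pyth Y : Y \in S ->
    frob_norm (Y - Z) ^+ 2 = frob_norm (Y - P) ^+ 2 + frob_norm (P - Z) ^+ 2.
  move=> YS; have -> : Y - Z = (Y - P) - (Z - P) by rewrite opprB addrA subrK.
  rewrite (@frob_pythagoras _ _ _ (Z - P)) ?orthP ?rpredB // -(opprB P Z).
  by rewrite !frob_norm_sqr frob_innerNl frob_innerC frob_innerNl opprK.
split=> [|Y [YS minY]].
  by split=> // Y YS; rewrite (pyth Y YS) lerDr sqr_ge0.
(* Testing the minimality of [Y] against the competitor [P] leaves a squared norm of [Y - P] that is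
   at most 0. *)
have := minY P PS; rewrite (pyth Y YS) gerDr frob_norm_sqr => YP_le0.
apply/esym/eqP; rewrite -subr_eq0 -frob_inner_eq0.
by rewrite eq_le YP_le0 frob_inner_ge0.
Qed.

Lemma tr_sym_mx (R : rcfType) (n : nat) (A : 'M[R]_n) :
  (sym_mx A)^T = sym_mx A.
Proof. by rewrite /sym_mx linearZ linearD /= trmxK addrC. Qed.

Lemma sym_mxD (R : rcfType) (n : nat) (A : 'M[R]_n) :
  sym_mx A + sym_mx A = A + A^T.
Proof.
by rewrite /sym_mx -scalerDl -mulr2n -(mulr_natl _^-1) divff ?scale1r ?pnatr_eq0.
Qed.

(** As [U^T *m U] is the identity, [U^T] sends the projection to [U^T *m Z0 - S]. Adding the
    transpose leaves twice the symmetric part of [U^T *m Z0] minus two copies of [S], which is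
    zero. *)
Lemma tangent_proj_tangent (R : rcfType) (d r k : nat)
    (G : 'M[R]_(d, k)) (U Z : 'M[R]_(d, r)) :
  G^T *m G = 1%:M -> U \in manifold G ->
  tangent_proj G U Z \in tangent_space G U.
Proof.
move=> hG; rewrite inE => /andP[/eqP UU /eqP GU].
rewrite inE /tangent_proj; set Z0 := _ *m Z; set S := sym_mx _.
(* Orthonormal columns give [G^T *m G *m G^T = G^T], so [G^T] annihilates [1%:M - G *m G^T]. *)
have GZ0 : G^T *m Z0 = 0.
  by rewrite mulmxA mulmxBr mulmx1 mulmxA hG mul1mx subrr mul0mx.
have UP : U^T *m (Z0 - U *m S) = U^T *m Z0 - S.
  by rewrite mulmxBr (mulmxA _ U) UU mul1mx.
have PU : (Z0 - U *m S)^T *m U = (U^T *m Z0)^T - S.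
  by rewrite -[LHS]trmxK trmx_mul trmxK UP linearB /= tr_sym_mx.
by rewrite UP PU addrACA -opprD sym_mxD subrr mulmxBr GZ0 mulmxA GU mul0mx
  subr0 !eqxx.
Qed.

Lemma tangent_proj_orthogonal (R : rcfType) (d r k : nat)
    (G : 'M[R]_(d, k)) (U Z Y : 'M[R]_(d, r)) :
  Y \in tangent_space G U -> frob_inner (Z - tangent_proj G U Z) Y = 0.
Proof.
rewrite inE => /andP[UY /eqP GY]; rewrite /tangent_proj.
set S := sym_mx _.
have -> : Z - ((1%:M - G *m G^T) *m Z - U *m S) = G *m (G^T *m Z) + U *m S.
  by rewrite mulmxBl mul1mx mulmxA !opprB addrC -addrA subrK addrC.
(* Moving [G] and [U] across as adjoints pairs [G^T *m Z] with [G^T *m Y = 0], and [S] with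
   [U^T *m Y], whose skewness is the first tangency equation. *)
rewrite frob_innerDl !(frob_inner_mull _ _ Y) GY {1}/frob_inner mulmx0 mxtrace0 add0r.
apply: frob_inner_sym_skew; first exact: tr_sym_mx.
by rewrite trmx_mul trmxK; apply/eqP; rewrite -addr_eq0 addrC.
Qed.

Theorem proposition3p1 (R : rcfType) (d r k : nat)
    (G : 'M[R]_(d, k)) (hG : G^T *m G = 1%:M)
    (U : 'M[R]_(d, r)) (hU : U \in manifold G) (Z : 'M[R]_(d, r)) :
  unique
    (is_minimizer (tangent_space G U) (fun Y => frob_norm (Y - Z) ^+ 2))
    (tangent_proj G U Z)
  /\ is_orthogonal_projection (tangent_space G U) Z (tangent_proj G U Z).
Proof.
have orthP :
    is_orthogonal_projection (tangent_space G U) Z (tangent_proj G U Z).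
  by split=> [|Y]; [exact: tangent_proj_tangent | exact: tangent_proj_orthogonal].
by split=> //; exact: orthogonal_projection_unique_minimizer.
Qed.
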